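(* Let $\alpha,\beta$ be real numbers satisfying one of the following two conditions: (i) $\alpha\geq\frac12$ and $\beta=-\frac12$; (ii) $\alpha\geq\beta\geq\frac12$. Then for every integer $n\geq 0$ the Jacobi polynomial $P_n^{(\alpha,\beta)}$ satisfies $$P_n^{(\alpha,\beta)}(1)-P_n^{(\alpha,\beta)}(x)\;\geq\;(1-x)\,\frac{d}{dx}\big\{P_n^{(\alpha,\beta)}(x)\big\}\qquad\text{for all } x\in[0,1].$$ Moreover, unless $\alpha=\beta=\frac12$, for every $n\geq 3$ equality in this inequality (for $x\in[0,1]$) is attained only at $x=1$.
   Context: For $\alpha,\beta>-1$ and an integer $n\ge 0$, $P_n^{(\alpha,\beta)}$ denotes the $n$-th degree Jacobi polynomial: the polynomials $\{P_n^{(\alpha,\beta)}\}_{n\ge 0}$ have $\deg P_n^{(\alpha,\beta)}=n$ and are orthogonal on $[-1,1]$ with respect to the weight function $(1-x)^{\alpha}(1+x)^{\beta}$, with the standard normalization $P_n^{(\alpha,\beta)}(1)=\binom{n+\alpha}{n}=\frac{\Gamma(n+\alpha+1)}{\Gamma(\alpha+1)\,n!}>0$. *)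

(* Defs.v *)
From HB Require Import structures.
From mathcomp Require Import all_boot all_order all_algebra.
From mathcomp Require Import all_classical all_reals all_analysis.

Set Implicit Arguments.
Unset Strict Implicit.
Unset Printing Implicit Defensive.

Import Order.TTheory GRing.Theory Num.Theory.
Import numFieldNormedType.Exports.
Local Open Scope classical_set_scope.
Local Open Scope ring_scope.

(* The binomial coefficient z (z - 1) ... (z - n + 1) / n! with a real upper
   argument; for z = n + a it equals Gamma(n + a + 1) / (Gamma(a + 1) n!). *)
Definition gbinom (R : realType) (z : R) (n : nat) : R :=
  (\prod_(i < n) (z - i%:R)) / n`!%:R.

(* [powR] sets 0 `^ a = 0 for a != 0, so for a negative exponent the weight
   is wrong at one endpoint, a null set for the Lebesgue integrals below. *)
Definition jacobi_weight (R : realType) (a b x : R) : R :=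
  (1 - x) `^ a * (1 + x) `^ b.

(* Intended for a, b > -1: then every polynomial is integrable against the
   weight and exactly one family P satisfies the three conditions. *)
Definition jacobi_family (R : realType) (a b : R) (P : nat -> {poly R}) : Prop :=
  [/\ forall n, size (P n) = n.+1,
      forall m n, m <> n ->
        \int[@lebesgue_measure R]_(x in `[-1, 1])
           (jacobi_weight a b x * (P m).[x] * (P n).[x]) = 0
    & forall n, (P n).[1] = gbinom (n%:R + a) n].

(* Main.v *)
Require Import Defs.
From HB Require Import structures.
From mathcomp Require Import all_boot all_order all_algebra.
From mathcomp Require Import all_classical all_reals all_analysis.
From mathcomp Require Import measurable_realfun ring lra.
Import Order.TTheory GRing.Theory Num.Theory.
Import numFieldNormedType.Exports.
Local Open Scope classical_set_scope.
Local Open Scope ring_scope.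

(** Write T_p(x) = p(1) - p(x) - (1 - x) p'(x), the gap at 1 between p and its
    tangent line at x ([tangent_gap]); the claim is that this gap is
    nonnegative on [0, 1] for Jacobi polynomials. It is linear in p, so it
    suffices to write P_n^(a,b) as a combination with nonnegative coefficients
    of polynomials for which the claim is known: everything is reduced to the
    Chebyshev polynomials of the second kind U_n, that is, to a = b = 1/2.

    The case of U_n. The derivative of T_p is - (1 - x) p'', so at an interior
    minimum of the gap of p = U_n one has p'' = 0, and the differential
    equation then expresses p and p' through a single unknown v. The identity
    sin^2 + cos^2 = 1 for sin(N t) = U_n(cos t) sin t, N = n + 1, bounds v, and
    the resulting comparison collapses to
      l (1 - x)^2 x (x + 2) (l - 3) >= 0,  l = n (n + 2),
    which makes the gap positive at such a point ([chebU_gap_crit]). Hence the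
    gap is smallest at an endpoint; it vanishes at 1, and at 0 it is
    nonnegative, being zero for n >= 3 only if n = 1 modulo 4.

    The reduction. The differential operator D attached to (a, b)
    ([jacobi_op]) acts triangularly on the basis U_k when a >= b >= 1/2, and on
    W_k = U_k + U_(k-1) when b = -1/2 and a >= 1/2: it sends the k-th basis
    element p_k to - (l_k p_k + a nonnegative combination of the p_j, j < k),
    where l_k = k (k + a + b + 1) increases with k. Solving D P_n = - l_n P_n
    for the coordinates of P_n from the top one downwards therefore gives
    nonnegative coordinates ([connection_pos]). For the strict inequality, U_n
    and at least one of U_(n-1), U_(n-2) occur with a positive coefficient
    unless a = b = 1/2, and their gaps do not vanish together at 0.

    From orthogonality to the differential equation. D is symmetric for the
    weight, because p D q - q D p times the weight is the derivative of a
    function vanishing at both endpoints ([jacobi_int_pearson]). So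
    D P_n + l_n P_n, which has degree less than n, is orthogonal to itself, and
    it is zero since the weight is positive ([jacobi_family_ode]). *)

Set Implicit Arguments.
Unset Strict Implicit.
Unset Printing Implicit Defensive.

(** * The Jacobi differential operator and triangular systems *)

Section JacobiOperator.
Context {R : realType}.
Implicit Types (a b x : R) (p q : {poly R}).

Definition jacobi_op a b p : {poly R} :=
  (1 - 'X^2) * p^`()^`() + ((b - a)%:P - (a + b + 2)%:P * 'X) * p^`().

Definition jacobi_eigen a b (n : nat) : R := n%:R * (n%:R + a + b + 1).

Lemma jacobi_opD a b p q : jacobi_op a b (p + q) = jacobi_op a b p + jacobi_op a b q.
Proof. by rewrite /jacobi_op !derivD; ring. Qed.

Lemma jacobi_opZ a b c p : jacobi_op a b (c *: p) = c *: jacobi_op a b p.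
Proof. by rewrite /jacobi_op !derivZ -!mul_polyC; ring. Qed.

(** The operator is upper triangular on monomials with diagonal minus the
    eigenvalues, which yields both the degree bound and leading-coefficient
    comparisons. *)
Lemma coef_jacobi_op a b p i : (jacobi_op a b p)`_i =
  - jacobi_eigen a b i * p`_i + (b - a) * i.+1%:R * p`_i.+1
  + i.+2%:R * i.+1%:R * p`_i.+2.
Proof.
have D (s : {poly R}) j : s^`()`_j = j.+1%:R * s`_j.+1.
  by rewrite coef_deriv mulr_natl.
have X1 : ('X * p^`())`_i = i%:R * p`_i.
  by rewrite coefXM D; case: i => [|i]; first by rewrite mul0r.
have X2 : ('X^2 * p^`()^`())`_i = i%:R * (i%:R - 1) * p`_i.
  rewrite coefXnM !D; case: i {X1} => [|[|i]].
  - by rewrite ltn0Sn !mul0r.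
  - by rewrite ltnSn subrr mulr0 mul0r.
  rewrite ltnNge -[~~ _]/false (_ : i.+2 - 2 = i)%N ?subn2// mulrA.
  by rewrite -[X in _ * (X - 1)]natr1 addrK [X in X * _]mulrC.
rewrite /jacobi_op /jacobi_eigen mulrBl mul1r mulrBl -[_%:P * 'X * _]mulrA.
rewrite !(coefD, coefN, coefCM) X1 X2 !D.
ring.
Qed.

Lemma jacobi_eigen_lt a b n k : 0 <= a + b -> (k < n)%N ->
  jacobi_eigen a b k < jacobi_eigen a b n.
Proof.
move=> ab kn; rewrite /jacobi_eigen.
have k0 : 0 <= k%:R :> R by [].
have : k%:R < n%:R :> R by rewrite ltr_nat.
nra.
Qed.

(** The triangular system is solved from the top: the coefficient of degree m
    of the equation determines the last coordinate r = d m / (l n - l m) >= 0,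
    and removing r *: p m from q turns the right-hand side d into
    d k + r * e m k, which is at least d k. Carrying the lower bound d k on
    c k * (l n - l k) instead of mere nonnegativity of c is what later gives
    strictly positive coordinates. *)
Lemma connection_step a b n (p : nat -> {poly R}) (e : nat -> nat -> R) :
  (forall k, size (p k) = k.+1) ->
  (forall k, jacobi_op a b (p k) =
     - (jacobi_eigen a b k *: p k + \sum_(j < k) e k j *: p j)) ->
  (forall k j, (j < k)%N -> 0 <= e k j) ->
  (forall k, (k < n)%N -> jacobi_eigen a b k < jacobi_eigen a b n) ->
  forall m (d : nat -> R) q, (m <= n)%N -> (size q <= m)%N ->
    (forall k, (k < m)%N -> 0 <= d k) ->
    jacobi_op a b q + jacobi_eigen a b n *: q = \sum_(k < m) d k *: p k ->
  exists2 c : nat -> R, q = \sum_(k < m) c k *: p k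
    & forall k, (k < m)%N -> d k <= c k * (jacobi_eigen a b n - jacobi_eigen a b k).
Proof.
move=> szp opp e0 lt_eig; set l := jacobi_eigen a b.
elim=> [|m IH] d q mn szq d0 opq.
  exists (fun=> 0) => //; rewrite big_ord0.
  by apply/eqP; rewrite -size_poly_leq0.
have lm : 0 < l n - l m by rewrite subr_gt0 lt_eig.
pose r := d m / (l n - l m).
have r0 : 0 <= r by rewrite divr_ge0 ?d0// ltW.
have rE : r * (l n - l m) = d m by rewrite divfK// gt_eqF.
have topq : q`_m = r * (p m)`_m.
  have := congr1 (fun s : {poly R} => s`_m) opq.
  rewrite coefD coefZ coef_jacobi_op (nth_default 0 szq).
  rewrite (nth_default 0 (leqW szq)) big_ord_recr /= coefD coefZ coef_sum.
  rewrite big1 ?add0r => [|k _]; last first.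
    by rewrite coefZ nth_default ?mulr0// szp.
  rewrite -rE !mulr0 !addr0 -/l => E; apply: (mulfI (lt0r_neq0 lm)).
  by rewrite mulrA [_ * r]mulrC -E; ring.
have [||k km||c qE dc] := IH (fun k => d k + r * e m k) (q - r *: p m).
- exact: ltnW.
- apply/leq_sizeP => j; rewrite leq_eqVlt => /predU1P[<-|mj].
    by rewrite coefB coefZ topq subrr.
  by rewrite coefB coefZ !nth_default ?mulr0 ?subrr ?szp// (leq_trans szq).
- by rewrite addr_ge0 ?d0 ?(ltn_trans km)// mulr_ge0// e0.
- transitivity (jacobi_op a b q + l n *: q
    - r *: (jacobi_op a b (p m) + l n *: p m)).
    by rewrite jacobi_opD -scaleNr jacobi_opZ -!mul_polyC polyCN; ring.
  rewrite opq big_ord_recr /= opp -rE.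
  under [RHS]eq_bigr do rewrite scalerDl -scalerA.
  rewrite big_split/= -scaler_sumr -/(l m) -!mul_polyC polyCM polyCB; ring.
exists (fun k => if k == m then r else c k).
  rewrite big_ord_recr /= eqxx -[LHS](subrK (r *: p m)) qE; congr (_ + _).
  by apply: eq_bigr => k _; rewrite ltn_eqF.
move=> k; rewrite ltnS leq_eqVlt; case: eqVneq => [->|_ /= km].
  by rewrite rE.
by apply: le_trans (dc _ km); rewrite lerDl mulr_ge0// e0.
Qed.

(** A solution of degree n is, up to a scalar, p n plus a solution q' of the
    system of [connection_step] whose right-hand side is the row e n. The sign
    of the scalar r is read off from the values at 1, where every p k is
    positive. *)
Lemma connection_pos a b n (p : nat -> {poly R}) (e : nat -> nat -> R) q :
  0 <= a + b ->
  (forall k, size (p k) = k.+1) ->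
  (forall k, 0 < (p k).[1]) ->
  (forall k, jacobi_op a b (p k) =
     - (jacobi_eigen a b k *: p k + \sum_(j < k) e k j *: p j)) ->
  (forall k j, (j < k)%N -> 0 <= e k j) ->
  size q = n.+1 -> jacobi_op a b q = - (jacobi_eigen a b n *: q) -> 0 < q.[1] ->
  exists (r : R) (c : nat -> R), [/\ 0 < r, q = r *: (p n + \sum_(k < n) c k *: p k),
    forall k, (k < n)%N -> 0 <= c k
    & forall k, (k < n)%N -> 0 < e n k -> 0 < c k].
Proof.
move=> ab szp p1 opp e0 szq opq q1.
pose l := jacobi_eigen a b.
have lt_eig k : (k < n)%N -> l k < l n by exact: jacobi_eigen_lt.
have pn0 : lead_coef (p n) != 0 by rewrite lead_coef_eq0 -size_poly_gt0 szp.
have q0 : lead_coef q != 0 by rewrite lead_coef_eq0 -size_poly_gt0 szq.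
pose r := lead_coef q / lead_coef (p n).
have r0 : r != 0 by rewrite mulf_neq0// invr_eq0.
pose q' := r^-1 *: q - p n.
have [||||c qE dc] := connection_step szp opp e0 lt_eig
    (m := n) (d := e n) (q := q') => //.
- apply/leq_sizeP => j; rewrite leq_eqVlt => /predU1P[<-|nj].
    rewrite coefB coefZ; apply/eqP; rewrite subr_eq0; apply/eqP.
    move: pn0 q0; rewrite /r !lead_coefE szq szp /= => ? ?.
    by field; apply/andP.
  by rewrite coefB coefZ !nth_default ?mulr0 ?subrr ?szp ?szq.
- by move=> k kn; exact: e0.
- rewrite jacobi_opD jacobi_opZ -[- p n]scaleN1r jacobi_opZ opq opp.
  rewrite /q' -/l -!mul_polyC polyCN; ring.
have cP k : (k < n)%N -> 0 < l n - l k by move=> /lt_eig; rewrite subr_gt0.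
have c0 k : (k < n)%N -> 0 <= c k.
  by move=> kn; rewrite -(pmulr_lge0 _ (cP _ kn)) (le_trans (e0 _ _ kn))// dc.
have qE' : q = r *: (p n + \sum_(k < n) c k *: p k).
  by rewrite -qE /q' addrC subrK scalerA divff// scale1r.
exists r, c; split => //; last first.
  by move=> k kn ek; rewrite -(pmulr_lgt0 _ (cP _ kn)) (lt_le_trans ek)// dc.
move: q1; rewrite qE' hornerZ pmulr_lgt0// hornerD ltr_wpDr//.
rewrite horner_sum sumr_ge0// => k _.
by rewrite hornerZ mulr_ge0 ?c0// ltW.
Qed.

Definition tangent_gap p x := p.[1] - p.[x] - (1 - x) * p^`().[x].

Lemma tangent_gap_comb n (c : nat -> R) (p : nat -> {poly R}) x :
  tangent_gap (\sum_(k < n) c k *: p k) x = \sum_(k < n) c k * tangent_gap (p k) x.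
Proof.
rewrite /tangent_gap (_ : _^`() = \sum_(k < n) c k *: (p k)^`()).
  rewrite !horner_sum mulr_sumr -!sumrB.
  by apply: eq_bigr => k _; rewrite !hornerZ; ring.
by rewrite linear_sum; apply: eq_bigr => k _; exact: derivZ.
Qed.

Lemma tangent_gapZ c p x : tangent_gap (c *: p) x = c * tangent_gap p x.
Proof. by rewrite /tangent_gap derivZ !hornerZ; ring. Qed.

Lemma tangent_gapD p q x : tangent_gap (p + q) x = tangent_gap p x + tangent_gap q x.
Proof. by rewrite /tangent_gap derivD !hornerD; ring. Qed.

End JacobiOperator.

(** * Chebyshev polynomials of the second kind *)

Section Chebyshev.
Variable R : realType.
Implicit Types (x : R).

Fixpoint chebU (n : nat) : {poly R} :=
  if n is m.+1 then
    if m is k.+1 then 2%:P * 'X * chebU m - chebU k else 2%:P * 'X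
  else 1.

Lemma chebUSS n : chebU n.+2 = 2%:P * 'X * chebU n.+1 - chebU n.
Proof. by []. Qed.

Lemma size_chebU n : size (chebU n) = n.+1.
Proof.
suff : size (chebU n) = n.+1 /\ size (chebU n.+1) = n.+2 by case.
have szX (p : {poly R}) : p != 0 -> size (2%:P * 'X * p) = (size p).+1.
  move=> p0; rewrite -mulrA size_Cmul ?pnatr_eq0// mulrC size_mulX//.
elim: n => [|n [su sv]].
  by rewrite /= size_poly1 -[_ * 'X]mulr1 szX ?oner_neq0// size_poly1.
split=> //; rewrite chebUSS size_polyDl szX ?sv// -?size_poly_gt0 ?sv//.
by rewrite size_polyN su.
Qed.

Lemma chebU1 n : (chebU n).[1] = n.+1%:R.
Proof.
suff : (chebU n).[1] = n.+1%:R /\ (chebU n.+1).[1] = n.+2%:R by case.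
elim: n => [|n [u1 v1]]; first by rewrite !hornerE.
by split=> //; rewrite chebUSS !hornerE u1 v1 -!natr1; ring.
Qed.

(** At x = cos t this is sin^2 ((n + 1) t) + cos^2 ((n + 1) t) = 1; the
    recurrence preserves the quadratic form. *)
Lemma chebU_norm n x :
  (chebU n).[x] ^+ 2 - 2 * x * (chebU n).[x] * (chebU n.+1).[x]
  + (chebU n.+1).[x] ^+ 2 = 1.
Proof.
elim: n => [|n IH].
  by rewrite /= (hornerC 1 x : 1.[x] = 1) !(hornerM, hornerC, hornerX); ring.
by rewrite -[RHS]IH chebUSS !(hornerD, hornerN, hornerM, hornerC, hornerX); ring.
Qed.

(** These two first-order relations are proved together because the step for
    either one uses both; all other facts on derivatives follow from them. *)
Lemma chebU_deriv n :
  'X * (chebU n.+1)^`() - (chebU n)^`() = n.+1%:R%:P * chebU n.+1 /\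
  (chebU n.+1)^`() - 'X * (chebU n)^`() = n.+2%:R%:P * chebU n.
Proof.
elim: n => [|n].
  by rewrite /= -{1 3}(polyC1 R) !derivM !derivC !derivX; split; ring.
rewrite chebUSS; move: (chebU n) (chebU n.+1) => u v [uv1 uv2].
have du : u^`() = 'X * v^`() - n.+1%:R%:P * v by rewrite -uv1; ring.
have dv : (1 - 'X^2) * v^`() = n.+2%:R%:P * u - n.+1%:R%:P * 'X * v.
  by rewrite -uv2 du; ring.
rewrite derivB !derivM derivC derivX du.
rewrite -!natr1 !polyCD !polyC1 in dv *.
split; last by ring.
apply/eqP; rewrite -subr_eq0; apply/eqP.
transitivity (- ((1 - 'X^2) * v^`()) + (n%:R%:P + 1 + 1) * u
   - (n%:R%:P + 1) * 'X * v); first by ring.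
by rewrite dv; ring.
Qed.

Lemma chebU_derivSS n :
  (chebU n.+2)^`() = (chebU n)^`() + (2 * n.+2%:R) *: chebU n.+1.
Proof.
have [_ h2] := chebU_deriv n.+1; have [h1 _] := chebU_deriv n.
rewrite -mul_polyC polyCM -[LHS](subrK ('X * (chebU n.+1)^`())) h2.
rewrite -[_ * _^`()](subrK (chebU n)^`()) h1.
by rewrite -!natr1 !polyCD polyC1; ring.
Qed.

Lemma chebU_XderivSS n : 'X * (chebU n.+2)^`() - n.+2%:R *: chebU n.+2 =
  'X * (chebU n)^`() + n.+2%:R *: chebU n.
Proof.
rewrite chebU_derivSS chebUSS -!mul_polyC polyCM; ring.
Qed.

(** Eliminate the derivatives of U_(n-1) between the two relations of
    [chebU_deriv] and their derivatives. *)
Lemma chebU_ode n :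
  jacobi_op (1 / 2) (1 / 2) (chebU n) = - ((n%:R * (n%:R + 2)) *: chebU n).
Proof.
have -> : jacobi_op (1 / 2) (1 / 2) (chebU n) =
    (1 - 'X^2) * (chebU n)^`()^`() - 3%:P * 'X * (chebU n)^`().
  rewrite /jacobi_op subrr (_ : 1 / 2 + 1 / 2 + 2 = 3 :> R); last by lra.
  by rewrite polyC0; ring.
rewrite -mul_polyC polyCM polyCD.
case: n => [|n].
  by rewrite /= -(polyC1 R) !derivC !mulr0 subrr !mul0r oppr0.
have [h1 h2] := chebU_deriv n; move: (h1) (h2).
move=> /(congr1 (fun p : {poly R} => p^`())) + /(congr1 (fun p : {poly R} => p^`())).
rewrite !derivB !derivM !derivX !derivC => h3 h4.
move: h1 h2 h3 h4; rewrite -!natr1 !polyCD polyC1.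
set u := chebU n; set v := chebU n.+1; set N := n%:R%:P => h1 h2 h3 h4.
apply/eqP; rewrite -subr_eq0; apply/eqP.
have e1 : 'X * v^`() - u^`() - (N + 1) * v = 0 by rewrite h1 subrr.
have e3 : 1 * v^`() + 'X * v^`()^`() - u^`()^`() - (0 * v + (N + 1) * v^`()) = 0.
  by rewrite -h3; ring.
have e4 : v^`()^`() - (1 * u^`() + 'X * u^`()^`()) - (0 * u + (N + 1 + 1) * u^`()) = 0.
  by rewrite -h4; ring.
(* The combination is: the derivative of the second relation, minus X times
   the derivative of the first, minus (n + 3) times the first. *)
rewrite -[RHS](subrr 0) -[X in _ = X - _]e4 -[X in _ = _ - X](mulr0 'X).
rewrite -[in X in _ = _ - X]e3.
transitivity (v^`()^`() - (1 * u^`() + 'X * u^`()^`()) - (0 * u + (N + 1 + 1) * u^`())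
 - 'X * (1 * v^`() + 'X * v^`()^`() - u^`()^`() - (0 * v + (N + 1) * v^`()))
 - (N + 3%:P) * ('X * v^`() - u^`() - (N + 1) * v)).
  by ring.
by rewrite e1 mulr0 subr0.
Qed.

Definition chebU_deriv_coef (k j : nat) : R := if odd (k + j) then 2 * j.+1%:R else 0.
Definition chebU_Xderiv_coef (k j : nat) : R := if odd (k + j) then 0 else 2 * j.+1%:R.

Lemma chebU_deriv_sum k :
  (chebU k)^`() = \sum_(j < k) chebU_deriv_coef k j *: chebU j.
Proof.
suff : (chebU k)^`() = \sum_(j < k) chebU_deriv_coef k j *: chebU j /\
  (chebU k.+1)^`() = \sum_(j < k.+1) chebU_deriv_coef k.+1 j *: chebU j by case.
elim: k => [|k [IH1 IH2]].
  rewrite big_ord0 big_ord1 /chebU_deriv_coef /= -(polyC1 R) derivM !derivC derivX mul0r.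
  by split=> //; rewrite add0r !mulr1 -mul_polyC polyC1 mulr1.
split=> //; rewrite chebU_derivSS IH1 !big_ord_recr/= -addrA; congr (_ + _).
  by apply: eq_bigr => j _; rewrite /chebU_deriv_coef !addSn /= negbK.
rewrite /chebU_deriv_coef !addSn !addnS !addnn /= odd_double /= scale0r add0r.
by [].
Qed.

Lemma chebU_Xderiv_sum k : 'X * (chebU k)^`() =
  k%:R *: chebU k + \sum_(j < k) chebU_Xderiv_coef k j *: chebU j.
Proof.
suff : 'X * (chebU k)^`() =
    k%:R *: chebU k + \sum_(j < k) chebU_Xderiv_coef k j *: chebU j /\
  'X * (chebU k.+1)^`() =
    k.+1%:R *: chebU k.+1 + \sum_(j < k.+1) chebU_Xderiv_coef k.+1 j *: chebU j by case.
elim: k => [|k [IH1 IH2]].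
  rewrite big_ord0 big_ord1 /chebU_Xderiv_coef /= -(polyC1 R) derivM !derivC derivX.
  by rewrite !mul0r mulr0 !scale0r !add0r addr0 mulr1 scale1r mulrC.
split=> //.
rewrite -[LHS](subrK (k.+2%:R *: chebU k.+2)) chebU_XderivSS IH1 addrC; congr (_ + _).
rewrite !big_ord_recr/= (_ : chebU_Xderiv_coef k.+2 k.+1 = 0); last first.
  by rewrite /chebU_Xderiv_coef !addSn !addnS addnn /= odd_double.
rewrite (_ : chebU_Xderiv_coef k.+2 k = 2 * k.+1%:R); last first.
  by rewrite /chebU_Xderiv_coef !addSn addnn /= odd_double.
have -> : \sum_(j < k) chebU_Xderiv_coef k.+2 j *: chebU j =
    \sum_(j < k) chebU_Xderiv_coef k j *: chebU j.
  by apply: eq_bigr => j _; rewrite /chebU_Xderiv_coef !addSn /= negbK.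
set S := \sum_(_ < k) _.
by rewrite -!mul_polyC -!natr1 !(polyCD, polyCM, polyC1) polyC0; ring.
Qed.

(** Relative to the parameters (1/2, 1/2), the operator loses
    ((a - b) + (a + b - 1) x) d/dx; both coefficients are nonnegative for
    a >= b >= 1/2, and so are the coordinates of U_k' and x U_k'. *)
Lemma chebU_op a b k : jacobi_op a b (chebU k) =
  - (jacobi_eigen a b k *: chebU k +
     \sum_(j < k) ((a - b) * chebU_deriv_coef k j
                   + (a + b - 1) * chebU_Xderiv_coef k j) *: chebU j).
Proof.
transitivity (jacobi_op (1 / 2) (1 / 2) (chebU k) -
   ((a - b) *: (chebU k)^`() + (a + b - 1) *: ('X * (chebU k)^`()))).
  rewrite /jacobi_op subrr (_ : 1 / 2 + 1 / 2 + 2 = 3 :> R); last by lra.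
  by rewrite -!mul_polyC polyC0 !(polyCD, polyCN, polyC1); ring.
rewrite chebU_ode chebU_Xderiv_sum chebU_deriv_sum.
under [in RHS]eq_bigr do rewrite scalerDl -!scalerA.
rewrite big_split/= -!scaler_sumr /jacobi_eigen -!mul_polyC.
by rewrite !(polyCD, polyCN, polyCM, polyC1); ring.
Qed.

(** The polynomials sin ((n + 1/2) t) / sin (t / 2), x = cos t: up to a scalar,
    the Jacobi polynomials with parameters (1/2, -1/2). *)
Definition chebW n : {poly R} := chebU n + (if n is k.+1 then chebU k else 0).

Lemma size_chebW n : size (chebW n) = n.+1.
Proof.
case: n => [|n]; first by rewrite /chebW addr0 size_poly1.
by rewrite size_polyDl !size_chebU.
Qed.

Lemma chebW1_gt0 n : 0 < (chebW n).[1].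
Proof.
case: n => [|n]; first by rewrite /chebW addr0 chebU1.
by rewrite hornerD !chebU1 addr_gt0.
Qed.

Lemma chebW_Xderiv_sum k : (1 + 'X) * (chebW k)^`() =
  k%:R *: chebW k + \sum_(j < k) (2 * j%:R + 1) *: chebW j.
Proof.
elim: k => [|k IH].
  by rewrite big_ord0 /chebW !addr0 /= -(polyC1 R) derivC mulr0 scale0r.
have step : (1 + 'X) * ((chebW k.+1)^`() - (chebW k)^`()) =
    k.+1%:R *: (chebW k.+1 + chebW k).
  rewrite /chebW; case: k {IH} => [|k].
    rewrite /= -!(polyC1 R) !derivD derivM !derivC derivX -mul_polyC !polyC1.
    ring.
  rewrite (derivD (chebU k.+2)) (derivD (chebU k.+1)) chebU_derivSS chebUSS.
  by rewrite -!mul_polyC polyCM; ring.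
rewrite -[(chebW k.+1)^`()](subrK (chebW k)^`()) mulrDr step IH big_ord_recr /=.
rewrite -!mul_polyC -!natr1 !(polyCD, polyCM, polyC1).
set S := \sum_(_ < _) _; ring.
Qed.

Lemma chebW_ode n :
  jacobi_op (1 / 2) (- (1 / 2)) (chebW n) = - ((n%:R * (n%:R + 1)) *: chebW n).
Proof.
transitivity (jacobi_op (1 / 2) (1 / 2) (chebW n) + ('X - 1) * (chebW n)^`()).
  rewrite /jacobi_op subrr (_ : 1 / 2 + 1 / 2 + 2 = 3 :> R); last by lra.
  rewrite (_ : - (1 / 2) - 1 / 2 = - 1 :> R); last by lra.
  by rewrite add0r polyC0 polyCN polyC1; ring.
rewrite /chebW; case: n => [|n].
  rewrite !addr0 chebU_ode /= -(polyC1 R) derivC mulr0 !mul0r.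
  by rewrite !scale0r addr0.
rewrite jacobi_opD !chebU_ode derivD.
have [h1 h2] := chebU_deriv n; move: h1 h2.
rewrite -!mul_polyC -!natr1 !(polyCD, polyCM, polyC1).
move: (chebU n) (chebU n.+1) => u v h1 h2.
have e1 : 'X * v^`() - u^`() - (n%:R%:P + 1) * v = 0 by rewrite h1 subrr.
have e2 : v^`() - 'X * u^`() - (n%:R%:P + 1 + 1) * u = 0 by rewrite h2 subrr.
apply/eqP; rewrite -subr_eq0 -[X in _ == X](subrr 0) -[X in _ == X - _]e1.
by rewrite -[X in _ == _ - X]e2; apply/eqP; ring.
Qed.

(** For b = -1/2 the basis U_k would give coefficients of the wrong sign when
    a < 3/2; relative to (1/2, -1/2) the operator only loses
    (a - 1/2) (1 + x) d/dx, which is nonnegative on the basis W_k. *)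
Lemma chebW_op a k : jacobi_op a (- (1 / 2)) (chebW k) =
  - (jacobi_eigen a (- (1 / 2)) k *: chebW k +
     \sum_(j < k) ((a - 1 / 2) * (2 * j%:R + 1)) *: chebW j).
Proof.
transitivity (jacobi_op (1 / 2) (- (1 / 2)) (chebW k) -
   (a - 1 / 2) *: ((1 + 'X) * (chebW k)^`())).
  rewrite /jacobi_op -!mul_polyC.
  rewrite (_ : - (1 / 2) - 1 / 2 = - 1 :> R); last by lra.
  rewrite (_ : 1 / 2 - 1 / 2 + 2 = 2 :> R); last by lra.
  rewrite (_ : - (1 / 2) - a = - 1 - (a - 1 / 2)); last by lra.
  rewrite (_ : a - 1 / 2 + 2 = 2 + (a - 1 / 2)); last by lra.
  by rewrite !(polyCD (a - _), polyCD _ (a - _), polyCB, polyC1); ring.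
rewrite chebW_ode chebW_Xderiv_sum.
under [in RHS]eq_bigr do rewrite -!scalerA.
rewrite -!scaler_sumr /jacobi_eigen -!mul_polyC.
rewrite (_ : k%:R + a - 1 / 2 + 1 = k%:R + 1 + (a - 1 / 2)); last by lra.
by rewrite !(polyCM k%:R, polyCD _ (a - _)); ring.
Qed.

(** This is sin^2 + cos^2 = 1 for f = sin ((n + 1) t) = U_n (cos t) sin t:
    the first term is (n + 1)^2 f^2 and the second one is (df/dt)^2. *)
Lemma chebU_energy n x (u := (chebU n).[x]) (u' := (chebU n)^`().[x]) :
  n.+1%:R ^+ 2 * ((1 - x ^+ 2) * u ^+ 2) + (x * u - (1 - x ^+ 2) * u') ^+ 2 =
  n.+1%:R ^+ 2.
Proof.
have := chebU_norm n x; have [] := chebU_deriv n.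
move=> /(congr1 (horner^~ x)) + /(congr1 (horner^~ x)).
rewrite !(hornerD, hornerN, hornerM, hornerX, hornerC) -/u -/u' -[n.+2%:R]natr1.
move: (chebU n.+1).[x] ((chebU n.+1)^`()).[x] (n.+1%:R : R) => v v' N h1 h2 h3.
have -> : x * u - (1 - x ^+ 2) * u' = N * (v - x * u).
  have -> : N * (v - x * u) = N * v - x * ((N + 1) * u) + x * u by ring.
  by rewrite -h1 -h2; ring.
transitivity (N ^+ 2 * (u ^+ 2 - 2 * x * u * v + v ^+ 2)); first by ring.
by rewrite h3 mulr1.
Qed.

(** With U'' = 0 the differential equation reads l U = 3 x U', l = n (n + 2),
    so U = 3 x v and U' = l v for some v, and the gap is
    (n + 1) - (3 x + (1 - x) l) v. Dividing out v in [chebU_energy] shows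
    (n + 1)^2 - ((3 x + (1 - x) l) v)^2 = l (1 - x)^2 x (x + 2) (l - 3) v^2. *)
Lemma chebU_gap_crit n x : (2 <= n)%N -> 0 < x < 1 ->
  (chebU n)^`()^`().[x] = 0 -> 0 < tangent_gap (chebU n) x.
Proof.
move=> n2 /andP[x0 x1] U2.
have := chebU_energy n x.
have := congr1 (horner^~ x) (chebU_ode n).
rewrite /jacobi_op /tangent_gap chebU1 !(hornerD, hornerN, hornerM, hornerX, hornerC, hornerZ) U2.
rewrite -[n.+1%:R]natr1.
have n2' : 2 <= n%:R :> R by rewrite ler_nat.
move: (chebU n).[x] ((chebU n)^`()).[x] (n%:R : R) n2' => u u' m m2 ode energy.
pose l := m * (m + 2).
have l8 : 8 <= l by rewrite /l; nra.
have {}ode : l * u = 3 * x * u' by rewrite /l; nra.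
pose v := u' / l.
have u'E : u' = l * v by rewrite /v mulrC divfK// gt_eqF//; lra.
have uE : u = 3 * x * v.
  by apply: (@mulfI _ l); [rewrite gt_eqF//; lra|rewrite ode u'E; ring].
have vv : v ^+ 2 * (l * (1 - x) ^+ 2 * x * (x + 2) * (l - 3)) =
    (m + 1) ^+ 2 - ((3 * x + (1 - x) * l) * v) ^+ 2.
  by rewrite -energy u'E uE /l; ring.
have v0 : v != 0.
  apply/eqP => v0; move: energy; rewrite uE u'E v0.
  by apply/eqP; rewrite !(mulr0, expr0n, subr0, addr0)/= eq_sym expf_neq0// gt_eqF//; lra.
have : 0 < v ^+ 2 * (l * (1 - x) ^+ 2 * x * (x + 2) * (l - 3)).
  clear -x0 x1 l8 v0; clearbody v; clearbody l.
  by rewrite mulr_gt0 ?exprn_even_gt0//= !mulr_gt0//; lra.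
rewrite vv subr_gt0 uE u'E.
rewrite (_ : m + 1 - _ - _ = m + 1 - (3 * x + (1 - x) * l) * v); last by ring.
by move: (_ * v) => w w2; nra.
Qed.

Lemma chebU_gap0E n (u := (chebU n).[0]) (v := (chebU n.+1).[0]) :
  u * v = 0 /\ tangent_gap (chebU n) 0 = n.+1%:R - u + n.+1%:R * v.
Proof.
split.
  rewrite /u /v; elim: n {u v} => [|n IH].
    by rewrite /= hornerM hornerX !mulr0.
  rewrite chebUSS !(hornerD, hornerN, hornerM, hornerX, hornerC).
  by rewrite mulr0 mul0r add0r mulrN mulrC IH oppr0.
have [/(congr1 (horner^~ 0)) + _] := chebU_deriv n.
rewrite /tangent_gap chebU1 !(hornerD, hornerN, hornerM, hornerX, hornerC) -/u -/v.
by rewrite mul0r add0r => <-; rewrite subr0 mul1r.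
Qed.

Lemma chebU_gap0_ge0 n : 0 <= tangent_gap (chebU n) 0.
Proof.
have [uv ->] := chebU_gap0E n.
have := chebU_norm n 0; move: uv.
have : 1 <= n.+1%:R :> R by rewrite ler1n.
move: (chebU n).[0] (chebU n.+1).[0] (n.+1%:R : R) => u v N N1 uv.
rewrite mulr0 !mul0r subr0 => n1.
have [u0|u0] := eqVneq u 0; first by move: n1; rewrite u0; nra.
have v0 : v = 0 by apply: (mulfI u0); rewrite uv mulr0.
by move: n1; rewrite v0; nra.
Qed.

Lemma chebU_gap0_gt0 n : (0 < n)%N -> (chebU n.+1).[0] != -1 ->
  0 < tangent_gap (chebU n) 0.
Proof.
move=> n0; have [uv ->] := chebU_gap0E n.
have := chebU_norm n 0; move: uv.
have : 2 <= n.+1%:R :> R by rewrite ler_nat.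
move: (chebU n).[0] (chebU n.+1).[0] (n.+1%:R : R) => u v N N1 uv.
rewrite mulr0 !mul0r subr0 => n1 vN1.
have [u0|u0] := eqVneq u 0.
  have v1 : v = 1.
    apply/eqP; rewrite -subr_eq0.
    suff /eqP : (v - 1) * (v + 1) = 0.
      by rewrite mulf_eq0 (addr_eq0 v 1) (negPf vN1) orbF.
    by move: n1; rewrite u0 => n1; nra.
  by rewrite u0 v1; lra.
have v0 : v = 0 by apply: (mulfI u0); rewrite uv mulr0.
by move: n1; rewrite v0; nra.
Qed.

Lemma chebU_gap_small n x : (n <= 1)%N -> tangent_gap (chebU n) x = 0.
Proof.
case: n => [|[|//]] _; rewrite /tangent_gap chebU1 /=.
  by rewrite -(polyC1 R) derivC !hornerC mulr0 subrr subr0.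
by rewrite derivM derivC derivX !(hornerD, hornerM, hornerX, hornerC); ring.
Qed.

(** A zero of the gap inside the interval is a minimum as soon as the gap is
    nonnegative, so both claims come from [chebU_gap_crit]. *)
Lemma chebU_gap_itv n x : (2 <= n)%N ->
  (0 <= x <= 1 -> 0 <= tangent_gap (chebU n) x) /\
  (0 < x < 1 -> 0 < tangent_gap (chebU n) x).
Proof.
move=> n2.
pose h : {poly R} := (chebU n).[1]%:P - chebU n - (1 - 'X) * (chebU n)^`().
have hE y : h.[y] = tangent_gap (chebU n) y.
  by rewrite /tangent_gap !(hornerD, hornerN, hornerM, hornerX, hornerC).
have h' y : h^`().[y] = - ((1 - y) * (chebU n)^`()^`().[y]).
  rewrite /h !derivB derivM derivB derivX derivC -(polyC1 R) derivC.
  by rewrite !(hornerD, hornerN, hornerM, hornerX, hornerC); ring.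
have crit c : 0 < c < 1 -> (forall t, 0 < t < 1 -> h.[c] <= h.[t]) -> 0 < h.[c].
  move=> c01 cmin; rewrite hE; apply: chebU_gap_crit => //.
  have c0 : is_derive c 1 (horner h) 0.
    exact: (@derive1_at_min _ _ 0 1).
  have : h^`().[c] = 0 by rewrite derivE derive1E; exact: derive_val.
  rewrite h' => /eqP; rewrite oppr_eq0 mulf_eq0 subr_eq0.
  by case/andP: c01 => _ /gt_eqF -> /= /eqP.
have ge0 y : 0 <= y <= 1 -> 0 <= h.[y].
  move=> y01.
  have [||c c01 cmin] := @EVT_min R (horner h) 0 1 => //.
    by apply: continuous_subspaceT; exact: continuous_horner.
  apply: le_trans (cmin y _); last by rewrite in_itv.
  move: c01; rewrite in_itv/= => /andP[c0 c1].
  move: c0; rewrite le_eqVlt => /predU1P[<-|c0].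
    by rewrite hE chebU_gap0_ge0.
  move: c1; rewrite le_eqVlt => /predU1P[->|c1].
    by rewrite hE /tangent_gap !subrr mul0r subr0.
  apply/ltW/crit; first by rewrite c0.
  by move=> t /andP[t0 t1]; rewrite cmin// in_itv/= !ltW.
split; first by rewrite -hE; exact: ge0.
move=> x01; rewrite -hE lt_neqAle ge0 ?andbT; last first.
  by case/andP: x01 => ? ?; rewrite !ltW.
apply/eqP => hx0; suff : 0 < h.[x] by rewrite -hx0 ltxx.
by apply: crit => // t /andP[t0 t1]; rewrite -hx0 ge0// !ltW.
Qed.

Lemma chebU_gap_ge0 n x : 0 <= x <= 1 -> 0 <= tangent_gap (chebU n) x.
Proof.
have [n1 _|n2] := leqP n 1; first by rewrite chebU_gap_small.
by case: (chebU_gap_itv x n2).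
Qed.

End Chebyshev.

(** * Integration against the Jacobi weight *)

Section Weight.
Variable R : realType.
Notation mu := (@lebesgue_measure R).
Implicit Types (a b c x y : R) (f F : R -> R) (p q : {poly R}).

(** The integrand may blow up at the endpoints, as the Jacobi weight does for
    negative exponents. The difference of F and the indefinite integral has
    zero derivative inside and is continuous up to the boundary. *)
Lemma FTC2_integrable f F a b : a < b ->
  mu.-integrable `[a, b] (EFin \o f) ->
  {in `]a, b[, continuous f} ->
  {within `[a, b], continuous F} ->
  (forall x, x \in `]a, b[ -> is_derive x 1 F (f x)) ->
  \int[mu]_(x in `[a, b]) f x = F b - F a.
Proof.
move=> ab fint fcont Fcont Ff.
pose G x := \int[mu]_(t in `[a, x]) f t.
have Gcont : {within `[a, b], continuous G}.
  exact: parameterized_integral_continuous (ltW ab) fint.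
have [x xab||c _] := @MVT R (F - G) (fun=> 0) a b ab.
- have /andP[ax xb] : a < x < b by move: xab; rewrite in_itv.
  have [dG G'] := continuous_FTC1_closed xb fint ax (fcont x xab).
  have DG : is_derive x 1 G (f x) by split; [exact: dG|rewrite -derive1E].
  by rewrite -(subrr (f x)); apply: is_deriveB; exact: Ff.
- move=> x; apply: cvgB; [exact: Fcont|exact: Gcont].
rewrite mul0r !fctE {2}/G set_itv1 Rintegral_set1 subr0 -/(G b) => E.
by rewrite -[LHS]add0r -E addrAC subrK.
Qed.

Lemma is_derive_powR_1Dx c x : -1 < x ->
  is_derive x 1 (fun t => (1 + t) `^ c) (c * (1 + x) `^ (c - 1)).
Proof.
move=> x1; have x0 : 0 < 1 + x by lra.
have d1 : is_derive x 1 (fun t : R => 1 + t) 1.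
  by have := is_deriveD (is_derive_cst (1 : R) x 1) (is_derive_id x 1); rewrite add0r.
by have := is_derive1_comp (g := fun t : R => 1 + t) (is_derive1_powR c x0) d1; rewrite mulr1.
Qed.

Lemma is_derive_powR_1Bx c x : x < 1 ->
  is_derive x 1 (fun t => (1 - t) `^ c) (- (c * (1 - x) `^ (c - 1))).
Proof.
move=> x1; have x0 : 0 < 1 - x by lra.
have d1 : is_derive x 1 (fun t : R => 1 - t) (- 1).
  by have := is_deriveB (is_derive_cst (1 : R) x 1) (is_derive_id x 1); rewrite add0r.
by have := is_derive1_comp (g := fun t : R => 1 - t) (is_derive1_powR c x0) d1; rewrite mulrN1.
Qed.

Lemma powR_1Dx_cvg0 c : 0 < c -> (1 + t) `^ c @[t --> (-1 : R)^'+] --> 0.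
Proof.
move=> c0; have h : 1 + t @[t --> (-1 : R)^'+] --> (0 : R)^'+.
  move=> A [e /= e0 eA]; exists e => //= y ye y1; apply: eA => /=; last lra.
  by move: ye; rewrite /= (_ : -1 - y = 0 - (1 + y)); last ring.
exact: cvg_comp h (powR_cvg0 c0).
Qed.

Lemma powR_1Bx_cvg0 c : 0 < c -> (1 - t) `^ c @[t --> (1 : R)^'-] --> 0.
Proof.
move=> c0; have h : 1 - t @[t --> (1 : R)^'-] --> (0 : R)^'+.
  move=> A [e /= e0 eA]; exists e => //= y ye y1; apply: eA => /=; last lra.
  by move: ye; rewrite /= distrC (_ : y - 1 = 0 - (1 - y)); last ring.
exact: cvg_comp h (powR_cvg0 c0).
Qed.

Lemma is_derive_continuous (f : R -> R) x l : is_derive x 1 f l -> {for x, continuous f}.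
Proof.
by move=> fl; apply/differentiable_continuous/derivable1_diffP/ex_derive.
Qed.

(** Exhaust ]-1, 1] by the intervals [-1 + 1/(n+1), 1], on which the integral
    is bounded by the value at 1 of the primitive
    (1 + x)^(b + 1) / (b + 1). *)
Lemma integrable_powR_1Dx b : -1 < b ->
  mu.-integrable `[-1, 1] (fun x => ((1 + x) `^ b)%:E).
Proof.
move=> b1.
have mf A : measurable_fun A (fun x : R => ((1 + x) `^ b)%:E).
  have m1 : measurable_fun A (fun x : R => 1 + x) by exact: measurable_funD.
  by apply/measurable_EFinP; exact: measurableT_comp (measurable_powR b) m1.
apply/integrableP; split; first exact: mf.
under eq_integral do rewrite gee0_abs ?lee_fin ?powR_ge0//.
rewrite -integral_itv_obnd_cbnd; last exact: mf.
rewrite itv_open_bnd_bigcup.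
pose F (n : nat) : set R := [set` `[-1 + n.+1%:R^-1, 1]].
have n1 n : n.+1%:R^-1 <= 1 :> R by rewrite invf_le1// ler1n.
have n0 n : 0 < n.+1%:R^-1 :> R by rewrite invr_gt0.
have Fnd : nondecreasing_seq F.
  apply/nondecreasing_seqP => n; rewrite subsetEset /F => x /=.
  rewrite !in_itv/= => /andP[h ->]; rewrite andbT; apply: le_trans h.
  by rewrite lerD2l lef_pV2 ?posrE// ler_nat.
have mF i : measurable (F i) by exact: measurable_itv.
have F0 i x : F i x -> (0 <= ((1 + x) `^ b)%:E)%E by rewrite lee_fin powR_ge0.
have cvgF := @ge0_nondecreasing_set_cvg_integral _ (measurableTypeR R) R F
  (fun x => ((1 + x) `^ b)%:E) lebesgue_measure Fnd mF (fun i => mf _) F0.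
rewrite -(cvg_lim _ cvgF)//.
apply: (@le_lt_trans _ _ (2 `^ (b + 1) / (b + 1))%:E); last exact: ltry.
apply: lime_le; first by apply/cvg_ex; eexists; exact: cvgF.
apply: nearW => n.
have dG (x : R) : -1 < x ->
    is_derive x 1 (fun t => (b + 1)^-1 * (1 + t) `^ (b + 1)) ((1 + x) `^ b).
  move=> x1; have := is_derive_powR_1Dx (b + 1) x1.
  move=> /(is_deriveZ (b + 1)^-1)/is_derive_eq; apply.
  by rewrite addrK scalerA mulVf ?scale1r// gt_eqF//; lra.
rewrite (@continuous_FTC2 R _ (fun t => (b + 1)^-1 * (1 + t) `^ (b + 1))); last first.
- move=> x; rewrite in_itv/= => /andP[xn _].
  rewrite derive1E; apply: derive_val; apply: dG.
  by rewrite (lt_trans _ xn)// ltrDl.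
- split.
  + move=> x; rewrite in_itv/= => /andP[xn _].
    by apply: ex_derive; apply: dG; rewrite (lt_trans _ xn)// ltrDl.
  + have h : -1 < -1 + n.+1%:R^-1 :> R by rewrite ltrDl.
    exact: cvg_at_right_filter (is_derive_continuous (dG _ h)).
  + have h : -1 < 1 :> R by lra.
    exact: cvg_at_left_filter (is_derive_continuous (dG _ h)).
- apply: continuous_in_subspaceT => x; rewrite inE/= in_itv/= => /andP[xn _].
  have h : -1 < x by rewrite (lt_le_trans _ xn)// ltrDl.
  exact: is_derive_continuous (is_derive_powR_1Dx b h).
- by have := n1 n; move: (_^-1) => t; lra.
rewrite -EFinD lee_fin mulrC (_ : 1 + 1 = 2)// lerBlDr lerDl.
by rewrite mulr_ge0 ?powR_ge0// invr_ge0; lra.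
Qed.

Lemma poly_bounded_itv p a b : exists M, forall x, a <= x <= b -> `|p.[x]| <= M.
Proof.
have : bounded_set (horner p @` `[a, b]).
  apply: compact_bounded; apply: continuous_compact; last exact: segment_compact.
  by apply: continuous_subspaceT; exact: continuous_horner.
move=> [M [_ MP]]; exists (M + 1) => x xab.
by apply: (MP (M + 1)); [rewrite ltrDl|exists x => //=; rewrite in_itv].
Qed.

Lemma integrable_weight a b p : 0 <= a -> -1 < b ->
  mu.-integrable `[-1, 1] (fun x => (jacobi_weight a b x * p.[x])%:E).
Proof.
move=> a0 b1; pose h x := (1 - x) `^ a * p.[x].
have mh (A : set (measurableTypeR R)) : measurable_fun A h.
  have m1 : measurable_fun A (fun x : R => 1 - x) by exact: measurable_funB.
  apply: measurable_funM; last exact: measurable_poly.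
  exact: measurableT_comp (measurable_powR a) m1.
have hb : [bounded h x | x in `[-1, 1]%classic].
  have [M MP] := poly_bounded_itv p (-1) 1.
  exists (2 `^ a * M); split; first exact: num_real.
  move=> N MN x /=; rewrite in_itv/= => x11; apply: le_trans (ltW MN).
  have /andP[x1 x2] := x11.
  rewrite normrM (ger0_norm (powR_ge0 _ _)) ler_pM ?powR_ge0 ?MP//.
  by rewrite ge0_ler_powR// ?nnegrE; lra.
have := integrableMr _ (mh _) hb (integrable_powR_1Dx b1).
move=> /(_ (measurable_itv _)); apply: eq_integrable => // x _.
by rewrite /= -EFinM; congr EFin; rewrite /jacobi_weight /h mulrAC.
Qed.

Definition jacobi_int a b p := \int[mu]_(x in `[-1, 1]) (jacobi_weight a b x * p.[x]).

Lemma jacobi_intD a b p q : 0 <= a -> -1 < b ->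
  jacobi_int a b (p + q) = jacobi_int a b p + jacobi_int a b q.
Proof.
move=> a0 b1; rewrite /jacobi_int -RintegralD//; try exact: integrable_weight.
by apply: eq_Rintegral => x _; rewrite hornerD mulrDr.
Qed.

Lemma jacobi_intZ a b c p : 0 <= a -> -1 < b ->
  jacobi_int a b (c *: p) = c * jacobi_int a b p.
Proof.
move=> a0 b1; rewrite /jacobi_int -RintegralZl//; try exact: integrable_weight.
by apply: eq_Rintegral => x _; rewrite hornerZ mulrCA.
Qed.

(** The integrand is the derivative of (1 - x)^(a+1) (1 + x)^(b+1) p, which
    vanishes at -1 and at 1. *)
Lemma jacobi_int_pearson a b p : 0 <= a -> -1 < b ->
  jacobi_int a b
    ((1 - 'X^2) * p^`() + ((b - a)%:P - (a + b + 2)%:P * 'X) * p) = 0.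
Proof.
move=> a0 b1; set q := (X in jacobi_int _ _ X).
pose F x := (1 - x) `^ (a + 1) * (1 + x) `^ (b + 1) * p.[x].
have F1 : F 1 = 0 by rewrite /F subrr powR0 ?mul0r// gt_eqF//; lra.
have FN1 : F (-1) = 0 by rewrite /F subrr powR0 ?mulr0 ?mul0r// gt_eqF//; lra.
have wd c d (r : {poly R}) x : -1 < x < 1 -> is_derive x 1
    (fun t => (1 - t) `^ c * (1 + t) `^ d * r.[t])
    ((1 - x) `^ c * (1 + x) `^ d * r^`().[x] +
     (((1 - x) `^ c * (d * (1 + x) `^ (d - 1))) +
     (- (c * (1 - x) `^ (c - 1))) * (1 + x) `^ d) * r.[x]).
  move=> /andP[x1 x2].
  have := is_deriveM (is_deriveM (is_derive_powR_1Bx c x2)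
    (is_derive_powR_1Dx d x1)) (is_derive_poly r x).
  move/is_derive_eq; apply; rewrite mulrfctE.
  transitivity ((1 - x) `^ c * (1 + x) `^ d * r^`().[x] +
    r.[x] * ((1 - x) `^ c * (d * (1 + x) `^ (d - 1)) +
             (1 + x) `^ d * - (c * (1 - x) `^ (c - 1)))); first by [].
  by ring.
have Fd x : -1 < x < 1 -> is_derive x 1 F (jacobi_weight a b x * q.[x]).
  move=> x11; have := wd (a + 1) (b + 1) p x x11; move/is_derive_eq; apply.
  case/andP: x11 => x1 x2.
  rewrite !addrK -(mulr_powRB1 (x := 1 - x) (p := a + 1)) ?addrK; [|lra|lra].
  rewrite -(mulr_powRB1 (x := 1 + x) (p := b + 1)) ?addrK; [|lra|lra].
  rewrite /q /jacobi_weight !(hornerD, hornerN, hornerM, hornerC, hornerX).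
  ring.
have N11 : -1 < 1 :> R by lra.
rewrite /jacobi_int (@FTC2_integrable _ F) ?F1 ?FN1 ?subrr//.
- exact: integrable_weight.
- move=> x; rewrite in_itv/= => x11; exact: is_derive_continuous (wd a b q x x11).
- apply/continuous_within_itvP => //; split.
  + by move=> x; rewrite in_itv/= => x11; exact: is_derive_continuous (Fd x x11).
  + rewrite FN1 -(mul0r p.[-1]) -(mulr0 ((1 - -1) `^ (a + 1))).
    apply: cvgM; last by apply: cvg_at_right_filter; exact: continuous_horner.
    apply: cvgM; last by apply: powR_1Dx_cvg0; lra.
    by apply: cvg_at_right_filter; exact: is_derive_continuous (is_derive_powR_1Bx (a + 1) N11).
  + rewrite F1 -(mul0r p.[1]) -(mul0r ((1 + 1) `^ (b + 1))).
    apply: cvgM; last by apply: cvg_at_left_filter; exact: continuous_horner.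
    apply: cvgM; first by apply: powR_1Bx_cvg0; lra.
    by apply: cvg_at_left_filter; exact: is_derive_continuous (is_derive_powR_1Dx (b + 1) N11).
Qed.

(** If the integral vanishes then so does the integrand almost everywhere,
    but the weight is positive on ]-1, 1[ and p has finitely many roots. *)
Lemma jacobi_int_sqr_eq0 a b p : 0 <= a -> -1 < b ->
  jacobi_int a b (p ^+ 2) = 0 -> p = 0.
Proof.
move=> a0 b1 int0; apply/eqP/negPn/negP => p0.
pose f x := (jacobi_weight a b x * (p ^+ 2).[x])%:E.
have fint : mu.-integrable `[-1, 1] f by exact: integrable_weight.
have f0 x : (0 <= f x)%E.
  rewrite lee_fin mulr_ge0 ?horner_exp ?sqr_ge0//.
  by rewrite mulr_ge0 ?powR_ge0.
have /ae_eq_integral_abs : (\int[mu]_(x in `[(-1)%R, 1%R]) `|f x| = 0)%E.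
  under eq_integral do rewrite gee0_abs//.
  move: int0; rewrite /jacobi_int /Rintegral => /eqP; rewrite fine_eq0.
    by move=> /eqP.
  exact: integrable_fin_num.
case=> [//||N [mN N0 sub]]; first exact: measurable_int fint.
have fin_roots : finite_set [set x | root p x].
  apply: contrapT => /(infinite_set_fset (size p))[B BP sB].
  have Broots : all (root p) (finmap.enum_fset B) by apply/allP => x /BP.
  have := max_poly_roots p0 Broots (finmap.fset_uniq B).
  by rewrite ltnNge sB.
have croots := finite_set_countable fin_roots.
have mroots : measurable ([set x | root p x] : set (measurableTypeR R)).
  exact: countable_measurable.
have : (mu `](-1)%R, 1%R[%classic <= mu (N `|` [set x | root p x]))%E.
  apply: le_measure; rewrite ?inE//; first exact: measurableU.
  move=> x /=; rewrite in_itv/= => /andP[x1 x2].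
  have [px|px] := boolP (root p x); [by right|left].
  apply: sub => /= /(_ _) E.
  have : f x = 0%E by apply: E; rewrite in_itv/= !ltW.
  move=> [] /eqP; rewrite mulf_eq0 mulf_eq0 !powR_eq0 horner_exp expf_eq0/=.
  have z1 : (1 - x == 0) = false by apply/gt_eqF; lra.
  have z2 : (1 + x == 0) = false by apply/gt_eqF; lra.
  by rewrite -rootE (negPf px) z1 z2.
apply/negP; rewrite -ltNge.
have -> : mu (N `|` [set x | root p x]) = 0%E.
  apply/eqP; rewrite -measure_le0; apply: le_trans.
    exact: (@measureU2 _ _ _ lebesgue_measure _ _ mN mroots).
  rewrite [X in (X + _)%E](_ : _ = 0%E) ?N0// add0e.
  rewrite [X in (X <= _)%E](_ : _ = 0%E) //.
  exact: countable_lebesgue_measure0.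
by rewrite lebesgue_measure_itv/= lte_fin ifT; [rewrite -EFinD lte_fin|]; lra.
Qed.

End Weight.

(** * From orthogonality to the differential equation *)

Section JacobiFamily.
Variable R : realType.
Implicit Types (a b c x y : R) (p q : {poly R}).

Lemma size_jacobi_op a b p m : (size p <= m)%N -> (size (jacobi_op a b p) <= m)%N.
Proof.
move=> sp; apply/leq_sizeP => j mj; have pj := leq_trans sp mj.
by rewrite coef_jacobi_op !nth_default ?mulr0 ?addr0// !(leq_trans pj)// leqW.
Qed.

(** The difference of the two integrands is the Pearson expression of the
    Wronskian s = p' q - p q'. *)
Lemma jacobi_op_sym a b p q : 0 <= a -> -1 < b ->
  jacobi_int a b (jacobi_op a b p * q) = jacobi_int a b (p * jacobi_op a b q).
Proof.
move=> a0 b1; pose s := p^`() * q - p * q^`().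
have -> : jacobi_op a b p * q = p * jacobi_op a b q +
    ((1 - 'X^2) * s^`() + ((b - a)%:P - (a + b + 2)%:P * 'X) * s).
  by rewrite /jacobi_op /s derivB !derivM; ring.
by rewrite jacobi_intD// jacobi_int_pearson// addr0.
Qed.

Lemma jacobi_family_orth a b (P : nat -> {poly R}) n q :
  0 <= a -> -1 < b -> jacobi_family a b P ->
  (size q <= n)%N -> jacobi_int a b (P n * q) = 0.
Proof.
move=> a0 b1 [szP orthP _].
suff : forall m (r : {poly R}), (m <= n)%N -> (size r <= m)%N -> jacobi_int a b (P n * r) = 0.
  by apply.
elim=> [|m IH] r mn szr.
  have -> : P n * r = 0 *: P n.
    by rewrite (_ : r = 0) ?mulr0 ?scale0r//; apply/eqP; rewrite -size_poly_leq0.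
  by rewrite jacobi_intZ// mul0r.
have lP : (P m)`_m != 0.
  by have := lead_coef_eq0 (P m); rewrite lead_coefE szP /= -size_poly_eq0 szP => ->.
pose c := r`_m / (P m)`_m.
have -> : P n * r = P n * (r - c *: P m) + c *: (P m * P n).
  by rewrite -!mul_polyC; ring.
rewrite jacobi_intD// jacobi_intZ// IH ?(ltnW mn)//; last first.
  apply/leq_sizeP => j; rewrite leq_eqVlt => /predU1P[<-|mj].
    by rewrite coefB coefZ /c divfK// subrr.
  by rewrite coefB coefZ !nth_default ?mulr0 ?subrr ?szP// (leq_trans szr).
have mn' : m <> n by move=> mn'; rewrite mn' ltnn in mn.
rewrite add0r (_ : jacobi_int _ _ _ = 0) ?mulr0// -[RHS](orthP m n mn').
by apply: eq_Rintegral => x _; rewrite hornerM mulrA.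
Qed.

(** The residue r has degree less than n since the leading terms cancel, so
    it is orthogonal to P n; by symmetry it is also orthogonal to D (P n),
    hence to itself. *)
Lemma jacobi_family_ode a b (P : nat -> {poly R}) n :
  0 <= a -> -1 < b -> jacobi_family a b P ->
  jacobi_op a b (P n) = - (jacobi_eigen a b n *: P n).
Proof.
move=> a0 b1 HP; have szP : size (P n) = n.+1 by case: HP.
pose r := jacobi_op a b (P n) + jacobi_eigen a b n *: P n.
have szr : (size r <= n)%N.
  apply/leq_sizeP => j; rewrite leq_eqVlt => /predU1P[<-|nj].
    have z k : (n < k)%N -> (P n)`_k = 0 by move=> nk; rewrite nth_default ?szP.
    by rewrite coefD coefZ coef_jacobi_op (z n.+1)// (z n.+2)//; ring.
  by rewrite coefD coefZ !nth_default ?mulr0 ?addr0 ?szP//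
    (leq_trans (size_jacobi_op _ _ (leqnn _))) ?szP.
apply/eqP; rewrite -addr_eq0 -/r; apply/eqP.
apply: (jacobi_int_sqr_eq0 a0 b1).
have -> : r ^+ 2 = jacobi_op a b (P n) * r + jacobi_eigen a b n *: (P n * r).
  by rewrite expr2 {1}/r -!mul_polyC; ring.
rewrite jacobi_intD// jacobi_intZ// jacobi_op_sym//.
by rewrite !jacobi_family_orth ?size_jacobi_op// mulr0 addr0.
Qed.

End JacobiFamily.

(** * Tangent gaps of Jacobi polynomials *)

Section JacobiGap.
Variable R : realType.
Implicit Types (a x : R).

Lemma gap_connection_ge0 n (r : R) (c : nat -> R) (p : nat -> {poly R}) x :
  0 < r -> (forall k, (k < n)%N -> 0 <= c k) -> (forall k, 0 <= tangent_gap (p k) x) ->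
  0 <= tangent_gap (r *: (p n + \sum_(k < n) c k *: p k)) x.
Proof.
move=> r0 c0 px; rewrite tangent_gapZ tangent_gapD tangent_gap_comb.
rewrite mulr_ge0 ?(ltW r0)// addr_ge0// sumr_ge0// => k _.
by rewrite mulr_ge0// c0.
Qed.

(** Strict positivity only needs one term with a positive gap. *)
Lemma gap_connection_gt0 n j (r : R) (c : nat -> R) (p : nat -> {poly R}) x :
  0 < r -> (forall k, (k < n)%N -> 0 <= c k) -> (forall k, 0 <= tangent_gap (p k) x) ->
  (0 < tangent_gap (p n) x \/ [/\ (j < n)%N, 0 < c j & 0 < tangent_gap (p j) x]) ->
  0 < tangent_gap (r *: (p n + \sum_(k < n) c k *: p k)) x.
Proof.
move=> r0 c0 px strict; rewrite tangent_gapZ tangent_gapD tangent_gap_comb mulr_gt0//.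
case: strict => [pn|[jn cj pj]].
  by rewrite ltr_pwDl// sumr_ge0// => k _; rewrite mulr_ge0// c0.
rewrite ltr_wpDl// (bigD1 (Ordinal jn))//= ltr_pwDl ?mulr_gt0//.
by rewrite sumr_ge0// => k _; rewrite mulr_ge0// c0.
Qed.

Lemma gbinom_gt0 a n : 0 < a -> 0 < gbinom (n%:R + a) n.
Proof.
move=> a0; rewrite divr_gt0 ?ltr0n ?fact_gt0// prodr_gt0// => i _.
have : (i : nat)%:R <= n%:R :> R by rewrite ler_nat ltnW.
lra.
Qed.

Lemma chebW_gap_ge0 n x : 0 <= x <= 1 -> 0 <= tangent_gap (chebW R n) x.
Proof.
move=> x01; rewrite /chebW tangent_gapD addr_ge0 ?chebU_gap_ge0//.
case: n => [|n]; last exact: chebU_gap_ge0.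
by rewrite /tangent_gap deriv0 !horner0 mulr0 !subr0.
Qed.

(** The gap of U_k at 0 vanishes, for k >= 1, exactly when U_(k+1)(0) = -1.
    If this happens for k = n then U_n(0) = 0 and U_(n-1)(0) = 1, so it
    happens neither for k = n - 1 nor for k = n - 2. *)
Lemma chebU_gap0_pair n j : (3 <= n)%N -> (j = n.-1 \/ j = n.-2) ->
  0 < tangent_gap (chebU R n) 0 \/ 0 < tangent_gap (chebU R j) 0.
Proof.
move=> n3 jn; have [un|un] := eqVneq (chebU R n.+1).[0] (-1); last first.
  by left; apply: chebU_gap0_gt0 => //; exact: leq_trans n3.
right; case: n n3 jn un => [|[|[|n]]] // _ jn un.
have E k : (chebU R k.+2).[0] = - (chebU R k).[0].
  by rewrite chebUSS !(hornerD, hornerN, hornerM, hornerX, hornerC) mulr0 mul0r add0r.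
case: jn => ->; [rewrite -[n.+3.-1]/n.+2|rewrite -[n.+3.-2]/n.+1];
  apply: chebU_gap0_gt0 => //.
  have [+ _] := chebU_gap0E R n.+3; rewrite un mulrN1 => /eqP.
  by rewrite oppr_eq0 => /eqP ->; rewrite eq_sym oppr_eq0 oner_eq0.
move: un; rewrite E => /eqP; rewrite eqr_opp => /eqP ->.
by rewrite -subr_eq0 opprK (_ : 1 + 1 = 2) ?pnatr_eq0.
Qed.

Lemma chebW_gap_gt0 n x : (3 <= n)%N -> 0 <= x < 1 -> 0 < tangent_gap (chebW R n) x.
Proof.
case: n => // n n3 /andP[]; rewrite le_eqVlt /chebW tangent_gapD => /predU1P[<- _|x0 x1].
  have [h|h] := chebU_gap0_pair (j := n) n3 (or_introl erefl).
    by rewrite ltr_pwDl// chebU_gap0_ge0.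
  by rewrite ltr_wpDl// chebU_gap0_ge0.
have [_ gt0] := chebU_gap_itv x (ltnW n3).
by rewrite ltr_pwDl ?gt0 ?x0// chebU_gap_ge0// !ltW.
Qed.

End JacobiGap.

Unset Implicit Arguments.
Set Strict Implicit.

Theorem theorem1 (R : realType) (a b : R) (P : nat -> {poly R})
    (hP : jacobi_family a b P)
    (hab : (1 / 2 <= a /\ b = - (1 / 2)) \/ (b <= a /\ 1 / 2 <= b)) :
  (forall (n : nat) (x : R), 0 <= x <= 1 ->
     (P n).[1] - (P n).[x] >= (1 - x) * (fun t : R => (P n).[t])^`()%classic x) /\
  (~ (a = 1 / 2 /\ b = 1 / 2) ->
   forall (n : nat) (x : R), (3 <= n)%N -> 0 <= x <= 1 ->
     ((P n).[1] - (P n).[x] = (1 - x) * (fun t : R => (P n).[t])^`()%classic x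
      <-> x = 1)).
Proof.
have a2 : 1 / 2 <= a by case: hab => -[]; lra.
have a0 : 0 < a by lra.
have b1 : -1 < b by case: hab => -[]; lra.
have ab0 : 0 <= a + b by case: hab => -[]; lra.
have ode n := jacobi_family_ode n (ltW a0) b1 hP.
have szP n : size (P n) = n.+1 by case: hP.
have P1 n : 0 < (P n).[1] by case: hP => _ _ ->; exact: gbinom_gt0.
suff [ge0 gt0] : (forall n x, 0 <= x <= 1 -> 0 <= tangent_gap (P n) x) /\
  (~ (a = 1 / 2 /\ b = 1 / 2) -> forall n x, (3 <= n)%N -> 0 <= x < 1 ->
     0 < tangent_gap (P n) x).
  have dE n (x : R) : (fun t : R => (P n).[t])^`()%classic x = (P n)^`().[x].
    by rewrite derivE.
  split=> [n x x01|nab n x n3 /andP[x0 x1]]; rewrite dE.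
    by rewrite -subr_ge0; exact: ge0.
  split=> [E|->]; last by rewrite !subrr mul0r.
  apply/eqP; apply: contraT => xN1.
  have := gt0 nab n x n3; rewrite x0 lt_neqAle xN1 x1 => /(_ isT).
  by rewrite /tangent_gap E subrr ltxx.
(* The basis is W_k for b = -1/2 and U_k for b >= 1/2. *)
case: hab => [[_ bE]|[ba b2]].
  have conn n : exists (r : R) (c : nat -> R), [/\ 0 < r,
      P n = r *: (chebW R n + \sum_(k < n) c k *: chebW R k)
      & forall k, (k < n)%N -> 0 <= c k].
    have [||||||r [c [r0 -> c0 _]]] := @connection_pos R a b n (chebW R)
      (fun _ j => (a - 1 / 2) * (2 * j%:R + 1)) (P n) ab0 (@size_chebW R).
    - exact: chebW1_gt0.
    - by move=> k; rewrite bE; exact: chebW_op.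
    - move=> k j _; rewrite mulr_ge0 ?subr_ge0//.
    - exact: szP.
    - exact: ode.
    - exact: P1.
    by exists r, c.
  split=> [n x x01|_ n x n3 x01]; have [r [c [r0 -> c0]]] := conn n.
    by apply: gap_connection_ge0 => // k; exact: chebW_gap_ge0.
  apply: (gap_connection_gt0 (j := 0%N)) => //; last first.
    by left; exact: chebW_gap_gt0.
  by move=> k; apply: chebW_gap_ge0; case/andP: x01 => -> /ltW.
pose e (k j : nat) : R :=
  (a - b) * chebU_deriv_coef R k j + (a + b - 1) * chebU_Xderiv_coef R k j.
have conn n : exists (r : R) (c : nat -> R), [/\ 0 < r,
    P n = r *: (chebU R n + \sum_(k < n) c k *: chebU R k),
    forall k, (k < n)%N -> 0 <= c k
    & forall k, (k < n)%N -> 0 < e n k -> 0 < c k].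
  apply: (@connection_pos R a b n (chebU R) e (P n) ab0 (@size_chebU R)).
  - by move=> k; rewrite chebU1.
  - exact: chebU_op.
  - move=> k j _; rewrite /e /chebU_deriv_coef /chebU_Xderiv_coef.
    by rewrite addr_ge0// mulr_ge0//; try lra; case: ifP.
  - exact: szP.
  - exact: ode.
  - exact: P1.
split=> [n x x01|nab n x n3 /andP[x0 x1]]; have [r [c [r0 -> c0 cgt0]]] := conn n.
  by apply: gap_connection_ge0 => // k; exact: chebU_gap_ge0.
have ge0 k : 0 <= tangent_gap (chebU R k) x.
  by apply: chebU_gap_ge0; rewrite x0 ltW.
move: x0; rewrite le_eqVlt => /predU1P[x0|x0]; last first.
  apply: (gap_connection_gt0 (j := 0%N)) => //; left.
  by have [_ ->] := chebU_gap_itv x (ltnW n3); rewrite ?x0.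
subst x.
(* At 0 the gap of U_n may vanish. For a > b the coordinate on U_(n-1) is
   positive, for a = b > 1/2 the one on U_(n-2) is. *)
have [j jn ej] : exists2 j, j = n.-1 \/ j = n.-2 & 0 < e n j.
  case: n n3 {c0 cgt0} => [|[|[|n]]]// _.
  have [ab|ab] := eqVneq a b.
    exists n.+1; first by right.
    rewrite /e /chebU_deriv_coef /chebU_Xderiv_coef !addSn !addnS addnn /= odd_double /=.
    rewrite mulr0 add0r !mulr_gt0//.
    have : b <> 1 / 2 by move=> b12; apply: nab; rewrite ab.
    by move=> /eqP; rewrite neq_lt => /orP[]; lra.
  exists n.+2; first by left.
  rewrite /e /chebU_deriv_coef /chebU_Xderiv_coef !addSn !addnS addnn /= odd_double /=.
  rewrite mulr0 addr0 !mulr_gt0// subr_gt0 lt_neqAle ba andbT eq_sym.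
  exact: ab.
apply: (gap_connection_gt0 (j := j)) => //.
have jlt : (j < n)%N.
  by case: jn => ->; case: (n) n3 => [|[|m]] // _; rewrite /= ?ltnS ?leqnSn.
have [h|h] := chebU_gap0_pair R n3 jn; [by left|right].
by split => //; exact: cgt0.
Qed.
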